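(* Let $n$ be any positive integer. Then for $2\le k\le n$, $$B_{n,k}(1!u_1,2!u_2,\ldots,(n-k+1)!u_{n-k+1})=\sum_{j=0}^{n-k}(j+1)(n-1)_j\,u_{j+1}\,B_{n-j-1,k-1}(1!u_1,2!u_2,\ldots,(n-j-k+1)!u_{n-j-k+1}).$$ Alternatively, for $2\le k\le n-1$, $$B_{n,k}(1!u_1,2!u_2,\ldots,(n-k+1)!u_{n-k+1})=u_1B_{n-1,k-1}(1!u_1,2!u_2,\ldots,(n-k+1)!u_{n-k+1})+\sum_{j=1}^{n-k}(j+1)u_{j+1}\frac{\partial}{\partial u_j}B_{n-1,k}(1!u_1,2!u_2,\ldots,(n-k)!u_{n-k}).$$
   Context: $(m)_j=m(m-1)\cdots(m-j+1)$ denotes the falling factorial, with $(m)_0=1$. For integers $1\le k\le n$, the partial exponential Bell polynomial is $$B_{n,k}(x_1,\ldots,x_{n-k+1})=n!\sum_{\Lambda^k_n}\prod_{j=1}^{n-k+1}\frac{1}{k_j!}\Big(\frac{x_j}{j!}\Big)^{k_j},$$ where the sum is over $\Lambda^k_n=\{(k_1,\ldots,k_{n-k+1}): \sum_j k_j=k,\ \sum_j jk_j=n,\ k_j\in\mathbb{Z}_{\ge 0}\}$. The partial derivative $\partial/\partial u_j$ is taken of the whole expression $B_{n-1,k}(1!u_1,\ldots,(n-k)!u_{n-k})$ as a polynomial in $u_1,u_2,\ldots$. *)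

(* Defs.v *)
From HB Require Import structures.
From mathcomp Require Import all_boot all_order all_algebra.
From mathcomp Require Import mpoly.

Set Implicit Arguments.
Unset Strict Implicit.
Unset Printing Implicit Defensive.

Import GRing.Theory.
Local Open Scope ring_scope.

(* Indices are shifted: coordinate i of a multi-exponent (resp. the variable
   'X_i) stands for k_(i+1) (resp. x_(i+1), u_(i+1)). *)

(* The bound mdeg m < k.+1 built into the type only makes it finite; it is
   implied by mdeg m = k. *)
Definition bell_index (n k : nat) : {set 'X_{1..(n - k).+1 < k.+1}} :=
  [set m : 'X_{1..(n - k).+1 < k.+1} |
     (\sum_(i < (n - k).+1) (m : 'X_{1..(n - k).+1}) i == k)%N
     && (\sum_(i < (n - k).+1) i.+1 * (m : 'X_{1..(n - k).+1}) i == n)%N].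

(* Meaningful for 1 <= k <= n, over a field of characteristic 0. *)
Definition bell (F : fieldType) (n k : nat) : {mpoly F[(n - k).+1]} :=
  (n`!)%:R *: \sum_(m in bell_index n k)
    \prod_(i < (n - k).+1)
      (((m : 'X_{1..(n - k).+1}) i)`!%:R^-1
         *: ((i.+1)`!%:R^-1 *: 'X_i) ^+ ((m : 'X_{1..(n - k).+1}) i)).

(* The ambient ring {mpoly F[N.+1]} has the indeterminates u_1, ..., u_(N+1);
   var_idx and uvar are meaningful only for 1 <= j <= N.+1. *)
Definition var_idx (N j : nat) : 'I_N.+1 := inord j.-1.

Definition uvar (F : fieldType) (N j : nat) : {mpoly F[N.+1]} := 'X_(var_idx N j).

(* B_(n,k)(1! u_1, 2! u_2, ..., (n-k+1)! u_(n-k+1)) *)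
Definition bell_fact (F : fieldType) (N n k : nat) : {mpoly F[N.+1]} :=
  bell F n k \mPo [tuple (i.+1)`!%:R *: uvar F N i.+1 | i < (n - k).+1].

(* Main.v *)
(* Put W(t) = u_1 + u_2 t + u_3 t^2 + ... .  The multinomial theorem gives
   B_(n,k)(1! u_1, 2! u_2, ...) = n!/k! [t^(n-k)] W^k = n!/k! [t^n] (t W)^k.
   Taking coefficients in ((t W)^k)' = k (t W)' (t W)^(k-1) yields the first
   recurrence.  Differentiating in u_j instead gives
   d/du_j B_(n,k) = (n)_j B_(n-j,k-1), which turns the terms j >= 1 of the first
   recurrence into those of the second. *)

Require Import Defs.
From mathcomp Require Import all_boot all_order all_algebra.
From mathcomp Require Import mpoly zify.

Import GRing.Theory.
Local Open Scope ring_scope.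

Lemma mderiv_exp (n : nat) (R : comNzRingType) (i : 'I_n) (p : {mpoly R[n]})
    (k : nat) :
  (p ^+ k)^`M(i) = p^`M(i) * p ^+ k.-1 *+ k.
Proof.
elim: k => [|k IHk]; first by rewrite expr0 -mpolyC1 mderivC mulr0n.
rewrite exprS mderivM IHk -mulrnAr mulrCA mulrS; congr (_ + _).
by case: k {IHk} => [|k]; rewrite ?mulr0n ?mulr0 //= mulrnAr mulrnAr -exprS.
Qed.

Lemma mderiv_sumX (n : nat) (R : comNzRingType) (i : 'I_n) :
  (\sum_(j < n) 'X_j : {mpoly R[n]})^`M(i) = 1.
Proof.
rewrite raddf_sum /= (bigD1 i) //= mderivX mnm1E eqxx scale1r.
rewrite (_ : U_(i) - U_(i) = 0)%MM; last by apply/mnmP=> j; rewrite mnmBE subnn mnm0E.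
rewrite mpolyX0 big1 ?addr0 // => j /negPf nji.
by rewrite mderivX mnm1E nji scale0r.
Qed.

Lemma dhomog_sumX (n : nat) (R : comNzRingType) :
  (\sum_(j < n) 'X_j : {mpoly R[n]}) \is 1.-homog.
Proof. by apply: rpred_sum => j _; rewrite dhomogX; apply/eqP/mdeg1. Qed.

(** The multinomial theorem with denominators cleared, so that it holds over any commutative ring.
    Induction on [k]: differentiating the power in one variable lowers both [k] and one exponent of
    [m]. *)
Lemma mcoeff_sumX_exp (n : nat) (R : comNzRingType) (k : nat) (m : 'X_{1..n}) :
  ((\sum_(j < n) 'X_j : {mpoly R[n]}) ^+ k)@_m *+ (\prod_(i < n) (m i)`!)%N
  = (k`! * (mdeg m == k))%:R.
Proof.
have hS j : (\sum_(i < n) 'X_i : {mpoly R[n]}) ^+ j \is j.-homog.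
  by have := dhomogMn j (dhomog_sumX n R); rewrite mul1n.
elim: k m => [|k IHk] m.
  rewrite expr0 mcoeff1 mul1n mdeg_eq0; case: eqP => [->|_]; last exact: mul0rn.
  by rewrite big1 // => i _; rewrite mnm0E.
have [mk|nmk] := eqVneq (mdeg m) k.+1; last first.
  by rewrite (dhomog_nemf_coeff (hS k.+1) nmk) mul0rn muln0.
(* The variable to differentiate in must occur in [m]; then the truncated difference [m - U_(i)]
   loses nothing. *)
have [i mi_gt0] : exists i, (0 < m i)%N.
  apply/existsP; apply: contra_eqT mk; rewrite negb_exists => /forallP m0.
  by rewrite mdegE big1 // => i _; apply/eqP; rewrite -leqn0 leqNgt.
(* At [m - U_(i)], the derivative of the power has [m i] times the coefficient at [m]; by the power
   rule it is also [k.+1] times a coefficient of the [k]-th power. *)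
have := congr1 (mcoeff (m - U_(i))%MM)
  (mderiv_exp _ _ i (\sum_(j < n) 'X_j : {mpoly R[n]}) k.+1).
rewrite mderiv_sumX mul1r mcoeffMn mcoeff_deriv.
have mE : (m - U_(i) + U_(i) = m)%MM.
  apply/mnmP=> j; rewrite mnmDE mnmBE mnm1E.
  by case: eqVneq => [<-|_]; rewrite ?subnK // subn0 addn0.
rewrite mE /= => eqD; move: (IHk (m - U_(i))%MM).
have -> : mdeg (m - U_(i)) = k.
  by apply: succn_inj; rewrite -mk -{2}mE mdegD mdeg1 addn1.
have -> : (\prod_(j < n) (m j)`! = m i * \prod_(j < n) ((m - U_(i))%MM j)`!)%N.
  rewrite (bigD1 i) // [in RHS](bigD1 i) //= mulnA; congr (_ * _)%N.
    by rewrite mnmBE mnm1E eqxx subn1 -[in LHS](prednK mi_gt0) factS prednK.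
  by apply: eq_bigr => j nji; rewrite mnmBE mnm1E eq_sym (negPf nji) subn0.
move: eqD; rewrite mnmBE mnm1E eqxx subn1 prednK // => eqD IH.
by rewrite mulrnA eqD mulrnAC IH eqxx !muln1 factS mulnC natrM mulr_natr.
Qed.

(** The image of the multinomial expansion under the ring morphism that sends ['X_i] to
    [u i *: 'X^i]: the monomial [m] lands in degree [\sum_i i * m i]. *)
Lemma coef_poly_exp_multinomial (F : fieldType) (charF0 : [pchar F] =i pred0)
    (A : comAlgType F) (n k d : nat) (u : nat -> A) :
  ((\poly_(i < n) u i) ^+ k)`_d =
  k`!%:R *: \sum_(m : 'X_{1..n < k.+1}
                  | (mdeg m == k) && (\sum_(i < n) i * (m : 'X_{1..n}) i == d)%N)
     \prod_(i < n) (((m : 'X_{1..n}) i)`!%:R^-1 *: u i ^+ (m : 'X_{1..n}) i).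
Proof.
pose f : {rmorphism F -> {poly A}} := polyC \o in_alg A.
pose h (i : 'I_n) : {poly A} := u i *: 'X^i.
have natF_neq0 j : (0 < j)%N -> j%:R != 0 :> F.
  by move=> j_gt0; rewrite ((pcharf0P _).1 charF0) -lt0n.
have -> : \poly_(i < n) u i = mmap f h (\sum_(j < n) 'X_j).
  rewrite poly_def raddf_sum; apply: eq_bigr => i _.
  by rewrite /= mmapX mmap1U.
(* This size bound lets [mmapE] sum over the same finite type of exponents as the statement. *)
have msS : (msize ((\sum_(j < n) 'X_j : {mpoly F[n]}) ^+ k) <= k.+1)%N.
  rewrite mmeasureE; apply/bigmax_leqP_seq => m ms _.
  by have /dhomogP -> := dhomogMn k (dhomog_sumX n F); rewrite ?mul1n.
rewrite -rmorphXn /= (mmapE _ msS) coef_sum scaler_sumr.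
rewrite [RHS]big_mkcond /=; apply: eq_bigr => m _.
have -> : mmap1 h m = (\prod_(i < n) u i ^+ (m : 'X_{1..n}) i)
    *: 'X^(\sum_(i < n) i * (m : 'X_{1..n}) i).
  rewrite /mmap1 /h -mul_polyC -prodrXr rmorph_prod -big_split /=.
  by apply: eq_bigr => i _; rewrite exprZn -exprM -mul_polyC rmorphXn.
rewrite /f /= coefCM coefZ coefXn eq_sym.
have := mcoeff_sumX_exp n F k m.
have fact_neq0 : (\prod_(i < n) ((m : 'X_{1..n}) i)`!)%N%:R != 0 :> F.
  by rewrite natF_neq0 // prodn_gt0 // => i; apply: fact_gt0.
rewrite -[LHS]mulr_natr => coefE; rewrite (canRL (mulfK fact_neq0) coefE).
case: (mdeg m == k) => /=; last by rewrite muln0 mul0r scale0r mul0r.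
case: (_ == d); last by rewrite !mulr0.
rewrite muln1 mulr1 mulr_algl -scalerA scaler_prod; congr (_ *: (_ *: _)).
by rewrite natr_prod prodfV.
Qed.

Lemma eq_coef_exp (R : nzRingType) (p q : {poly R}) (d k : nat) :
  (forall i, (i <= d)%N -> p`_i = q`_i) ->
  forall i, (i <= d)%N -> (p ^+ k)`_i = (q ^+ k)`_i.
Proof.
move=> eq_pq; elim: k => [|k IHk] i le_id; first by rewrite !expr0.
rewrite !exprS !coefM; apply: eq_bigr => j _.
by rewrite eq_pq ?IHk // (leq_trans _ le_id) ?leq_subr // -ltnS.
Qed.

(** The series W of the overview, truncated after degree [N], where the variables run out. *)
Definition useries (F : fieldType) (N : nat) : {poly {mpoly F[N.+1]}} :=
  \poly_(i < N.+1) uvar F N i.+1.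

(** The bridge from Bell polynomials to powers of W. Only the coefficients of W up to degree [n - k]
    matter, and [n - k <= N] makes them genuine variables. *)
Lemma bell_factE (F : fieldType) (charF0 : [pchar F] =i pred0) (N n k : nat) :
  (k <= n)%N -> (n - k <= N)%N ->
  k`!%:R *: bell_fact F N n k = n`!%:R *: (useries F N ^+ k)`_(n - k).
Proof.
move=> le_kn le_nkN.
have -> : (useries F N ^+ k)`_(n - k) =
    ((\poly_(i < (n - k).+1) uvar F N i.+1) ^+ k)`_(n - k).
  apply: (@eq_coef_exp _ _ _ (n - k)) => // i le_i.
  by rewrite !coef_poly !ltnS le_i (leq_trans le_i).
rewrite coef_poly_exp_multinomial // /bell_fact /bell comp_mpolyZ (raddf_sum (comp_mpoly _)).
rewrite !scalerA mulrC; congr (_ *: _). apply: eq_big => m.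
  (* Index sets agree: once the exponents sum to [k], replacing the weights [i] by [i.+1] adds
     exactly [k] to the weighted sum. *)
  rewrite inE -mdegE; case: eqP => //= mk.
  rewrite -[RHS](eqn_add2r k) subnK //; congr (_ == _).
  rewrite -[X in (_ + X)%N]mk mdegE -big_split /=.
  by apply: eq_bigr => i _; rewrite mulSn addnC.
move=> _; rewrite [LHS](rmorph_prod (comp_mpoly _)) /=; apply: eq_bigr => i _.
(* The substituted factor [(i.+1)!] cancels the inverse factorial attached to ['X_i] in [bell]. *)
rewrite comp_mpolyZ rmorphXn /= comp_mpolyZ comp_mpolyXU.
rewrite -tnth_nth tnth_mktuple scalerA mulVf ?scale1r //.
by rewrite ((pcharf0P _).1 charF0) -lt0n fact_gt0.
Qed.

(** Differentiation in one variable, applied coefficientwise, is a derivation of the polynomials in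
    t, hence obeys the power rule; [dp] is the derivative of [p]. *)
Lemma coef_mderiv_exp (n : nat) (R : comNzRingType) (i : 'I_n)
    (p dp : {poly {mpoly R[n]}}) (k : nat) :
  (forall d, (p`_d)^`M(i) = dp`_d) ->
  forall d, ((p ^+ k)`_d)^`M(i) = (p ^+ k.-1 * dp)`_d *+ k.
Proof.
move=> dpE; elim: k => [|k IHk] d.
  by rewrite mulr0n expr0 coef1 -mpolyC_nat mderivC.
rewrite exprS coefM raddf_sum /=.
have -> : \sum_(j < d.+1) (p`_j * (p ^+ k)`_(d - j))^`M(i)
    = (dp * p ^+ k + p * (p ^+ k.-1 * dp *+ k))`_d.
  rewrite coefD !coefM -big_split /=; apply: eq_bigr => j _.
  by rewrite mderivM IHk dpE coefMn.
rewrite -coefMn mulrS [dp * _]mulrC mulrnAr mulrA.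
by case: k {IHk} => [|k]; rewrite ?mulr0n //= -exprS.
Qed.

Lemma mderiv_bell_fact (F : fieldType) (charF0 : [pchar F] =i pred0)
    (N n k j : nat) :
  (0 < k <= n)%N -> (n - k <= N)%N -> (0 < j <= (n - k).+1)%N ->
  (bell_fact F N n k)^`M(var_idx N j) =
    (n ^_ j)%:R *: bell_fact F N (n - j) k.-1.
Proof.
case: k => // k /andP[_ le_kn] le_nkN; case: j => // j /andP[_ le_jnk].
have kF : k.+1`!%:R != 0 :> F by rewrite ((pcharf0P _).1 charF0) -lt0n fact_gt0.
apply: (scalerI kF); rewrite -mderivZ bell_factE // mderivZ.
(* After the shift of [j], the variable is the coefficient of t^j in W, so W has derivative ['X^j].
   Truncation does no harm because [j <= n - k.+1 <= N]. *)
rewrite (coef_mderiv_exp _ _ _ _ 'X^j); last first.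
  move=> d; rewrite coef_poly coefXn; case: ltnP => [lt_dN|le_Nd]; last first.
    rewrite mderiv0; case: eqP => // eq_d; move: le_Nd.
    by rewrite eq_d ltnNge -ltnS (leq_trans le_jnk).
  rewrite /uvar mderivX mnm1E /var_idx -val_eqE /= !inordK //; last first.
    by rewrite (leq_trans le_jnk).
  case: eqVneq => [->|_]; last by rewrite scale0r.
  rewrite (_ : U_(_) - U_(_) = 0)%MM ?mpolyX0 ?scale1r //.
  by apply/mnmP=> l; rewrite mnmBE subnn mnm0E.
have le_jn : (j < n)%N by lia.
rewrite -(ffact_fact le_jn) natrM /= coefMXn ltnNge -ltnS le_jnk /=.
(* One factor [k.+1] is split off to match the one from the power rule, which leaves the [k!] that
   [bell_factE] expects. *)
have -> : (k.+1)`!%:R *: ((n ^_ j.+1)%:R *: bell_fact F N (n - j.+1) k) =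
    (n ^_ j.+1 * k.+1)%:R *: (k`!%:R *: bell_fact F N (n - j.+1) k).
  by rewrite !scalerA -!natrM factS; congr (_%:R *: _); rewrite mulnC mulnA.
rewrite (bell_factE _ charF0); [|lia..].
rewrite -scaler_nat !scalerA -!natrM; congr (_%:R *: _`__); lia.
Qed.

(** With t p in place of p, differentiation multiplies the coefficient p_j by [j.+1]; the identity
    is the coefficient of t^(d+k) in the derivative of (t p)^(k+1). *)
Lemma coef_exp_rec (R : comNzRingType) (p : {poly R}) (k d : nat) :
  (p ^+ k.+1)`_d *+ (d + k.+1) =
    (\sum_(j < d.+1) p`_j * (p ^+ k)`_(d - j) *+ j.+1) *+ k.+1.
Proof.
have := congr1 (fun q : {poly R} => q`_(d + k)) (deriv_exp (p * 'X) k.+1).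
rewrite /= !exprMn mulrA coefMn coef_deriv !coefMXn addnS.
rewrite ltnS subSS ltnNge leq_addl addnK /= => ->.
congr (_ *+ _); rewrite coefM; apply: eq_bigr => j _.
by rewrite coef_deriv coefMX /= mulrnAl.
Qed.

Lemma bell_fact_rec (F : fieldType) (charF0 : [pchar F] =i pred0)
    (N n k : nat) :
  (k <= n)%N -> (n - k <= N)%N ->
  bell_fact F N n.+1 k.+1 =
    \sum_(0 <= j < (n - k).+1)
      (j.+1 * n ^_ j)%:R *: (uvar F N j.+1 * bell_fact F N (n - j) k).
Proof.
move=> le_kn le_nkN.
have kF : k.+1`!%:R != 0 :> F by rewrite ((pcharf0P _).1 charF0) -lt0n fact_gt0.
apply: (scalerI kF); rewrite bell_factE // subSS big_mkord scaler_sumr.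
(* The factor [n.+1] of the factorial is exactly the multiplier [d + k.+1] of [coef_exp_rec] at
   [d = n - k]. *)
have -> : n.+1`!%:R *: (useries F N ^+ k.+1)`_(n - k) =
    n`!%:R *: ((useries F N ^+ k.+1)`_(n - k) *+ (n - k + k.+1)).
  by rewrite addnS subnK // -scaler_nat scalerA -natrM factS mulnC.
rewrite coef_exp_rec -scaler_nat scalerA scaler_sumr; apply: eq_bigr => j _.
have le_jnk : (j <= n - k)%N by rewrite -ltnS.
have le_jn : (j <= n)%N := leq_trans le_jnk (leq_subr _ _).
rewrite coef_poly ltnS (leq_trans le_jnk le_nkN).
have -> : (k.+1)`!%:R *: ((j.+1 * n ^_ j)%:R
      *: (uvar F N j.+1 * bell_fact F N (n - j) k)) =
    (k.+1 * (j.+1 * n ^_ j))%:R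
      *: (uvar F N j.+1 * (k`!%:R *: bell_fact F N (n - j) k)).
  by rewrite -scalerAr !scalerA -!natrM factS mulnAC.
rewrite (bell_factE _ charF0); [|lia..].
rewrite -scalerAr -scaler_nat !scalerA -!natrM -(ffact_fact le_jn).
congr (_%:R *: (_ * _`__)); last by rewrite subnAC.
by rewrite -!mulnA; lia.
Qed.

Theorem corollary2p4 (F : fieldType) (charF0 : [pchar F] =i pred0)
    (n : nat) (n_gt0 : (0 < n)%N) :
  (forall k N : nat, (2 <= k <= n)%N -> (n - k <= N)%N ->
     bell_fact F N n k =
       \sum_(0 <= j < (n - k).+1)
         (j.+1 * (n - 1) ^_ j)%:R *: (uvar F N j.+1
            * bell_fact F N (n - j - 1) (k - 1)))
  /\
  (forall k N : nat, (2 <= k <= n - 1)%N -> (n - k <= N)%N ->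
     bell_fact F N n k =
       uvar F N 1 * bell_fact F N (n - 1) (k - 1)
       + \sum_(1 <= j < (n - k).+1)
           (j.+1)%:R *: (uvar F N j.+1
              * (bell_fact F N (n - 1) k)^`M(var_idx N j))).
Proof.
case: n n_gt0 => // n _; rewrite subn1 /=.
split=> -[|k] N //=; rewrite subSS => /andP[k_gt0 le_kn] le_nkN.
  rewrite bell_fact_rec // subn1; apply: eq_bigr => j _.
  by rewrite subnAC subn1.
(* The term [j = 0] is the product with u_1; in the others [mderiv_bell_fact] turns the falling
   factorial and the smaller Bell polynomial into a partial derivative. *)
rewrite bell_fact_rec ?(ltnW le_kn) // [in LHS]big_nat_recl // big_add1 subn1 /=.
rewrite ffactn0 subn0 scale1r; congr (_ + _); apply: eq_big_nat => j /andP[_ lt_jnk].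
rewrite mderiv_bell_fact //; [|lia..].
by rewrite -scalerAr scalerA -natrM.
Qed.
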